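(* Assume that we can find an intuitionistic propositional formula $t(P,Q)$ in two variables so that (1) $\neg P\rightarrow Q,\ \neg Q\rightarrow P,\ \neg t(P,Q)\vdash_{\mathcal{L}} P$, and (2) $\neg P\rightarrow Q,\ \neg Q\rightarrow P,\ \neg\neg t(P,Q)\vdash_{\mathcal{L}} Q$ in a super-intuitionistic logic $\mathcal{L}$. Then $\mathcal{L}$ coincides with classical propositional logic.
   Context: Formulas of second-order intuitionistic propositional logic are built from countably many propositional variables and $\bot$ using $\wedge,\vee,\rightarrow$ and the propositional quantifiers $\forall X,\exists X$ (all primitive); $\neg A$ abbreviates $A\rightarrow\bot$. An intuitionistic propositional formula is a quantifier-free formula. A sequent $\Gamma\vdash A$ has a finite (possibly empty) sequence $\Gamma$ of formulas, considered up to order, on the left and a formula $A$ on the right; an empty right-hand side stands for $\bot$. The inference rules of second-order intuitionistic propositional logic are: the axiom $\varphi\vdash\varphi$; cut (from $\Gamma\vdash\varphi$ and $\Delta,\varphi\vdash\psi$ infer $\Gamma,\Delta\vdash\psi$); left weakening (from $\Gamma\vdash\psi$ infer $\Gamma,\varphi\vdash\psi$); left contraction (from $\Gamma,\varphi,\varphi\vdash\psi$ infer $\Gamma,\varphi\vdash\psi$); right weakening (from $\Gamma\vdash$ infer $\Gamma\vdash\varphi$); the usual Gentzen-style intuitionistic left and right rules for $\wedge,\vee,\rightarrow$; the axiom $\bot\vdash\varphi$; $\forall L$: from $\Gamma,\varphi[T/X]\vdash\psi$ infer $\Gamma,\forall X.\varphi\vdash\psi$; $\forall R$: from $\Gamma\vdash\varphi$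 infer $\Gamma\vdash\forall X.\varphi$; $\exists R$: from $\Gamma\vdash\varphi[T/X]$ infer $\Gamma\vdash\exists X.\varphi$; $\exists L$: from $\Gamma,\varphi\vdash\psi$ infer $\Gamma,\exists X.\varphi\vdash\psi$. Here, in $\forall L$ and $\exists R$, $T$ is a formula not using bound variables of $\varphi$ (substitution is capture-avoiding), and in $\forall R$ and $\exists L$ the variable $X$ must not occur free in the context ($\Gamma$, respectively $\Gamma,\psi$). A super-intuitionistic (second-order, propositional) logic $\mathcal{L}$ is a binary relation $\vdash_{\mathcal{L}}$ between finite sequences of formulas of second-order intuitionistic propositional logic on the left and a single such formula on the right, such that $\vdash_{\mathcal{L}}$ satisfies all the inference rules above. Classical propositional logic is the super-intuitionistic logic in which $\Gamma\vdash A$ holds iff $\Gamma,\ \forall X.(X\vee\neg X)\vdash A$ is derivable by the inference rules above (equivalently, one may use the axiom $\forall X.(\neg\neg X\rightarrow X)$).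
   Formalization: The logic L is additionally assumed consistent (⊥ is not derivable from the empty context), since the total relation satisfies all the rules and (1), (2) but does not coincide with classical logic. *)

(* Defs.v *)
From Stdlib Require Import List Permutation Arith.
Import ListNotations.

Definition var := nat.

Inductive form : Type :=
| Var (X : var)
| Bot
| And (A B : form)
| Or (A B : form)
| Imp (A B : form)
| All (X : var) (A : form)
| Ex (X : var) (A : form).

Definition Neg (A : form) : form := Imp A Bot.

Fixpoint quantifier_free (A : form) : Prop :=
  match A with
  | Var _ | Bot => True
  | And A B | Or A B | Imp A B => quantifier_free A /\ quantifier_free B
  | All _ _ | Ex _ _ => False
  end.

Fixpoint occurs (X : var) (A : form) : Prop :=
  match A with
  | Var Y => X = Y
  | Bot => False
  | And A B | Or A B | Imp A B => occurs X A \/ occurs X B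
  | All Y A | Ex Y A => X = Y \/ occurs X A
  end.

Fixpoint free (X : var) (A : form) : Prop :=
  match A with
  | Var Y => X = Y
  | Bot => False
  | And A B | Or A B | Imp A B => free X A \/ free X B
  | All Y A | Ex Y A => X <> Y /\ free X A
  end.

Fixpoint bound (X : var) (A : form) : Prop :=
  match A with
  | Var _ | Bot => False
  | And A B | Or A B | Imp A B => bound X A \/ bound X B
  | All Y A | Ex Y A => X = Y \/ bound X A
  end.

(** [subst X T A] is A[T/X]. It performs no renaming: it avoids capture only
    when no free variable of [T] is bound in [A], which [admissible] ensures
    wherever the rules below use it. *)
Fixpoint subst (X : var) (T A : form) : form :=
  match A with
  | Var Y => if Nat.eq_dec X Y then T else Var Y
  | Bot => Bot
  | And A B => And (subst X T A) (subst X T B)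
  | Or A B => Or (subst X T A) (subst X T B)
  | Imp A B => Imp (subst X T A) (subst X T B)
  | All Y A => All Y (if Nat.eq_dec X Y then A else subst X T A)
  | Ex Y A => Ex Y (if Nat.eq_dec X Y then A else subst X T A)
  end.

Definition admissible (T A : form) : Prop :=
  forall Y, occurs Y T -> ~ bound Y A.

Definition not_free_in (X : var) (G : list form) : Prop :=
  forall B, In B G -> ~ free X B.

(** An empty right-hand side is rendered as [Bot]; the last formula of a
    left-hand side "Γ, φ" is the head of the list. *)
Definition sequent : Type := (list form * form)%type.

Notation "G ⊢ A" := (@pair (list form) form G A) (at level 70, no associativity).

(** [inference ps s]: the sequent [s] follows from the premises [ps] by one
    rule. [i_exchange] renders "considered up to order". *)
Inductive inference : list sequent -> sequent -> Prop :=
| i_exchange G D A : Permutation G D -> inference [G ⊢ A] (D ⊢ A)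
| i_axiom A : inference [] ([A] ⊢ A)
| i_cut G D A B : inference [G ⊢ A; A :: D ⊢ B] (G ++ D ⊢ B)
| i_weakL G A B : inference [G ⊢ B] (A :: G ⊢ B)
| i_contrL G A B : inference [A :: A :: G ⊢ B] (A :: G ⊢ B)
| i_weakR G A : inference [G ⊢ Bot] (G ⊢ A)
| i_andL1 G A B C : inference [A :: G ⊢ C] (And A B :: G ⊢ C)
| i_andL2 G A B C : inference [B :: G ⊢ C] (And A B :: G ⊢ C)
| i_andR G A B : inference [G ⊢ A; G ⊢ B] (G ⊢ And A B)
| i_orL G A B C : inference [A :: G ⊢ C; B :: G ⊢ C] (Or A B :: G ⊢ C)
| i_orR1 G A B : inference [G ⊢ A] (G ⊢ Or A B)
| i_orR2 G A B : inference [G ⊢ B] (G ⊢ Or A B)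
| i_impL G D A B C :
    inference [G ⊢ A; B :: D ⊢ C] (Imp A B :: G ++ D ⊢ C)
| i_impR G A B : inference [A :: G ⊢ B] (G ⊢ Imp A B)
| i_botL A : inference [] ([Bot] ⊢ A)
| i_allL G X A T B : admissible T A ->
    inference [subst X T A :: G ⊢ B] (All X A :: G ⊢ B)
| i_allR G X A : not_free_in X G -> inference [G ⊢ A] (G ⊢ All X A)
| i_exR G X A T : admissible T A ->
    inference [G ⊢ subst X T A] (G ⊢ Ex X A)
| i_exL G X A B : not_free_in X (B :: G) ->
    inference [A :: G ⊢ B] (Ex X A :: G ⊢ B).

Inductive derivable : sequent -> Prop :=
| derivable_by ps s :
    inference ps s -> (forall p, In p ps -> derivable p) -> derivable s.

Definition super_intuitionistic (L : list form -> form -> Prop) : Prop :=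
  forall ps G A, inference ps (G ⊢ A) ->
    (forall D B, In (D ⊢ B) ps -> L D B) -> L G A.

Definition excluded_middle : form := All 0 (Or (Var 0) (Neg (Var 0))).

Definition classical_logic (G : list form) (A : form) : Prop :=
  derivable (excluded_middle :: G ⊢ A).

(* Main.v *)
Require Import Defs.
From Stdlib Require Import List Permutation Arith Bool Lia.
Import ListNotations.

(** One of the two hypotheses is double negation elimination in disguise.
    When [P] and [Q] both hold, structural induction decides the
    quantifier-free [t] intuitionistically: [P, Q] proves [t] or proves [¬t].
    - If [P, Q] proves [t], then [P, ¬¬Q] proves [¬¬t]. It also proves
      [¬P → Q] and [¬Q → P], so [h2] yields [P, ¬¬Q ⊢ Q].
    - If [P, Q] proves [¬t], then symmetrically [Q, ¬¬P] proves the three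
      premises of [h1], which yields [Q, ¬¬P ⊢ P].
    In both cases the logic has a sequent [R, ¬¬S ⊢ S] with [R] and [S] distinct
    variables. Generalizing, and instantiating [R] by a true formula and [S] by
    [X ∨ ¬X], gives the excluded middle ([excluded_middle_of_dne]), so the logic
    contains classical logic.

    The converse inclusion is Post completeness ([post_completeness]): no
    consistent logic properly extends the classical one. With excluded middle,
    the literals of a valuation prove or refute every formula according to its
    truth value ([literals_decide]). Hence a valid formula is classically
    derivable ([classical_completeness]), by case distinctions on its variables.
    If a consistent logic proved an invalid formula, it would also prove the
    universal closure, which is closed and false and hence refuted
    ([consistent_sound]). *)

(** * Natural deduction inside a super-intuitionistic logic *)

Lemma derivable_super_intuitionistic :
  super_intuitionistic (fun G A => derivable (G ⊢ A)).
Proof.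
  intros ps G A Hi Hp. apply (derivable_by _ _ Hi).
  intros [D B]; apply Hp.
Qed.

Lemma derivable_sub L (hL : super_intuitionistic L) G A :
  derivable (G ⊢ A) -> L G A.
Proof.
  enough (H : forall s, derivable s -> L (fst s) (snd s)) by apply (H (G ⊢ A)).
  induction 1 as [ps [D B] Hi _ IH].
  apply (hL _ _ _ Hi). intros E C; apply (IH (E ⊢ C)).
Qed.

Ltac rule hL r :=
  eapply hL;
  [ eapply r
  | let D := fresh in let B := fresh in let H := fresh in
    simpl; intros D B H; repeat destruct H as [H | H]; try contradiction;
    injection H as <- <- ].

Lemma absorb_hyp L (hL : super_intuitionistic L) G A B :
  In A G -> L (A :: G) B -> L G B.
Proof.
  intros (G1 & G2 & ->)%in_split H.
  rule hL i_exchange. { apply Permutation_middle. }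
  rule hL i_contrL.
  rule hL i_exchange; [ | exact H ].
  apply perm_skip, Permutation_sym, Permutation_middle.
Qed.

(** The structural rules together make contexts behave as sets; this is what
    allows the rules below to keep a single shared context. *)
Lemma weaken L (hL : super_intuitionistic L) G D A :
  incl G D -> L G A -> L D A.
Proof.
  intros Hi HG.
  assert (H : L (G ++ D) A).
  { rule hL i_exchange. { apply Permutation_app_comm. }
    clear Hi. induction D as [ | B D IH ]; [ exact HG | ].
    simpl. rule hL i_weakL. exact IH. }
  clear HG. induction G as [ | B G IH ]; [ exact H | ].
  apply IH. { intros C HC; apply Hi; right; exact HC. }
  apply (absorb_hyp L hL _ B); [ | exact H ].
  apply in_or_app; right; apply Hi; left; reflexivity.
Qed.

Lemma hyp L (hL : super_intuitionistic L) G A : In A G -> L G A.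
Proof.
  intros H. apply (weaken L hL [A]).
  - intros B [<- | []]; exact H.
  - rule hL i_axiom.
Qed.

Lemma cut L (hL : super_intuitionistic L) G A B :
  L G A -> L (A :: G) B -> L G B.
Proof.
  intros HA HB. apply (weaken L hL (G ++ G)). { apply incl_app; apply incl_refl. }
  rule hL i_cut; eassumption.
Qed.

Lemma impI L (hL : super_intuitionistic L) G A B :
  L (A :: G) B -> L G (Imp A B).
Proof. intros H. rule hL i_impR. exact H. Qed.

Lemma impE L (hL : super_intuitionistic L) G A B :
  L G (Imp A B) -> L G A -> L G B.
Proof.
  intros HAB HA. apply (cut L hL _ (Imp A B)); [ exact HAB | ].
  apply (weaken L hL (Imp A B :: G ++ G)).
  { intros C [<- | HC]; [ left | right; apply in_app_or in HC; tauto ]. reflexivity. }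
  rule hL i_impL; [ exact HA | apply (hyp L hL); left; reflexivity ].
Qed.

Lemma botE L (hL : super_intuitionistic L) G A : L G Bot -> L G A.
Proof. intros H. rule hL i_weakR. exact H. Qed.

Lemma andI L (hL : super_intuitionistic L) G A B :
  L G A -> L G B -> L G (And A B).
Proof. intros HA HB. rule hL i_andR; assumption. Qed.

Lemma andE1 L (hL : super_intuitionistic L) G A B : L G (And A B) -> L G A.
Proof.
  intros H. apply (cut L hL _ _ _ H). rule hL i_andL1.
  apply (hyp L hL); left; reflexivity.
Qed.

Lemma andE2 L (hL : super_intuitionistic L) G A B : L G (And A B) -> L G B.
Proof.
  intros H. apply (cut L hL _ _ _ H). rule hL i_andL2.
  apply (hyp L hL); left; reflexivity.
Qed.

Lemma orI1 L (hL : super_intuitionistic L) G A B : L G A -> L G (Or A B).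
Proof. intros H. rule hL i_orR1. exact H. Qed.

Lemma orI2 L (hL : super_intuitionistic L) G A B : L G B -> L G (Or A B).
Proof. intros H. rule hL i_orR2. exact H. Qed.

Lemma orE L (hL : super_intuitionistic L) G A B C :
  L G (Or A B) -> L (A :: G) C -> L (B :: G) C -> L G C.
Proof.
  intros H HA HB. apply (cut L hL _ _ _ H). rule hL i_orL; assumption.
Qed.

Lemma allI L (hL : super_intuitionistic L) G X A :
  not_free_in X G -> L G A -> L G (All X A).
Proof. intros HX H. rule hL i_allR; assumption. Qed.

Lemma allE L (hL : super_intuitionistic L) G X A T :
  admissible T A -> L G (All X A) -> L G (subst X T A).
Proof.
  intros HT H. apply (cut L hL _ _ _ H). rule hL i_allL; [ exact HT | ].
  apply (hyp L hL); left; reflexivity.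
Qed.

Lemma exI L (hL : super_intuitionistic L) G X A T :
  admissible T A -> L G (subst X T A) -> L G (Ex X A).
Proof. intros HT H. rule hL i_exR; eassumption. Qed.

Lemma exE L (hL : super_intuitionistic L) G X A B :
  not_free_in X (B :: G) -> L G (Ex X A) -> L (A :: G) B -> L G B.
Proof.
  intros HX H HA. apply (cut L hL _ _ _ H). rule hL i_exL; assumption.
Qed.

Ltac in_context := simpl; auto 8.

Lemma weaken_cons L (hL : super_intuitionistic L) G A B : L G B -> L (A :: G) B.
Proof. intros H. rule hL i_weakL. exact H. Qed.

(** * Truth values *)

Definition upd (v : var -> bool) (X : var) (b : bool) : var -> bool :=
  fun Y => if Nat.eq_dec X Y then b else v Y.

(** Second-order quantifiers range over the two truth values. *)
Fixpoint eval (v : var -> bool) (A : form) : bool :=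
  match A with
  | Var X => v X
  | Bot => false
  | And A B => eval v A && eval v B
  | Or A B => eval v A || eval v B
  | Imp A B => negb (eval v A) || eval v B
  | All X A => eval (upd v X true) A && eval (upd v X false) A
  | Ex X A => eval (upd v X true) A || eval (upd v X false) A
  end.

Lemma eval_ext A : forall v w,
  (forall X, free X A -> v X = w X) -> eval v A = eval w A.
Proof.
  assert (Hq : forall X B v w, (forall Y, Y <> X /\ free Y B -> v Y = w Y) ->
    forall b Y, free Y B -> upd v X b Y = upd w X b Y).
  { intros X B v w H b Y HY. unfold upd.
    destruct (Nat.eq_dec X Y) as [ | n ]; auto. }
  induction A as [ X | | A IHA B IHB | A IHA B IHB | A IHA B IHB
                 | X A IH | X A IH ];
    simpl; intros v w H; auto;
    try (rewrite (IHA v w), (IHB v w); auto; fail);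
    f_equal; apply IH, Hq, H.
Qed.

Definition const (b : bool) : form := if b then Imp Bot Bot else Bot.

(** The two constants contain no variables, hence can instantiate any
    quantifier, whatever is bound in its body. *)
Lemma const_admissible b A : admissible (const b) A.
Proof. intros Y; destruct b; simpl; tauto. Qed.

Lemma eval_subst_const X b A : forall v,
  eval v (subst X (const b) A) = eval (upd v X b) A.
Proof.
  assert (Hsame : forall B v c,
    eval (upd v X c) B = eval (upd (upd v X b) X c) B).
  { intros B v c; apply eval_ext; intros Y _; unfold upd.
    destruct (Nat.eq_dec X Y); reflexivity. }
  assert (Hswap : forall Y B v c, X <> Y ->
    eval (upd (upd v Y c) X b) B = eval (upd (upd v X b) Y c) B).
  { intros Y B v c n; apply eval_ext; intros Z _; unfold upd.
    destruct (Nat.eq_dec X Z), (Nat.eq_dec Y Z); congruence. }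
  induction A as [ Y | | A IHA B IHB | A IHA B IHB | A IHA B IHB
                 | Y A IH | Y A IH ];
    simpl; intros v; try (rewrite IHA, IHB); auto.
  - unfold upd. destruct (Nat.eq_dec X Y); [ destruct b | ]; reflexivity.
  - destruct (Nat.eq_dec X Y) as [ <- | n ].
    + rewrite <- !Hsame; reflexivity.
    + rewrite !IH, !Hswap by exact n; reflexivity.
  - destruct (Nat.eq_dec X Y) as [ <- | n ].
    + rewrite <- !Hsame; reflexivity.
    + rewrite !IH, !Hswap by exact n; reflexivity.
Qed.

Lemma free_subst_const X b A Y :
  free Y (subst X (const b) A) -> Y <> X /\ free Y A.
Proof.
  induction A as [ Z | | A IHA B IHB | A IHA B IHB | A IHA B IHB
                 | Z A IH | Z A IH ]; simpl; try tauto.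
  - destruct (Nat.eq_dec X Z) as [ <- | n ]; simpl.
    + destruct b; simpl; tauto.
    + intros ->; split; auto.
  - destruct (Nat.eq_dec X Z) as [ <- | n ]; tauto.
  - destruct (Nat.eq_dec X Z) as [ <- | n ]; tauto.
Qed.

(** Variables weigh as much as the larger constant, so that instantiating by a
    constant does not increase the weight. *)
Fixpoint weight (A : form) : nat :=
  match A with
  | Var _ => 1
  | Bot => 0
  | And A B | Or A B | Imp A B => S (weight A + weight B)
  | All _ A | Ex _ A => S (weight A)
  end.

Lemma weight_subst_const X b A : weight (subst X (const b) A) <= weight A.
Proof.
  induction A as [ Y | | A IHA B IHB | A IHA B IHB | A IHA B IHB
                 | Y A IH | Y A IH ]; simpl; try lia;
    destruct (Nat.eq_dec X Y); simpl; try lia.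
  destruct b; simpl; lia.
Qed.

(** * Literals decide formulas *)

Definition signed (b : bool) (A : form) : form := if b then A else Neg A.

Lemma signed_and L (hL : super_intuitionistic L) G a b A B :
  L G (signed a A) -> L G (signed b B) -> L G (signed (a && b) (And A B)).
Proof.
  intros HA HB. destruct a; simpl in *.
  - destruct b; simpl in *; [ apply (andI L hL); assumption | ].
    apply (impI L hL), (impE L hL _ B); [ apply (weaken_cons L hL), HB | ].
    apply (andE2 L hL _ A), (hyp L hL); in_context.
  - apply (impI L hL), (impE L hL _ A); [ apply (weaken_cons L hL), HA | ].
    apply (andE1 L hL _ _ B), (hyp L hL); in_context.
Qed.

Lemma signed_or L (hL : super_intuitionistic L) G a b A B :
  L G (signed a A) -> L G (signed b B) -> L G (signed (a || b) (Or A B)).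
Proof.
  intros HA HB. destruct a; simpl in *; [ apply (orI1 L hL), HA | ].
  destruct b; simpl in *; [ apply (orI2 L hL), HB | ].
  apply (impI L hL), (orE L hL _ A B).
  - apply (hyp L hL); in_context.
  - apply (impE L hL _ A); [ | apply (hyp L hL); in_context ].
    do 2 apply (weaken_cons L hL). exact HA.
  - apply (impE L hL _ B); [ | apply (hyp L hL); in_context ].
    do 2 apply (weaken_cons L hL). exact HB.
Qed.

Lemma signed_imp L (hL : super_intuitionistic L) G a b A B :
  L G (signed a A) -> L G (signed b B) ->
  L G (signed (negb a || b) (Imp A B)).
Proof.
  intros HA HB. destruct a; simpl in *.
  - destruct b; simpl in *.
    + apply (impI L hL), (weaken_cons L hL), HB.
    + apply (impI L hL), (impE L hL _ B); [ apply (weaken_cons L hL), HB | ].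
      apply (impE L hL _ A); [ | apply (weaken_cons L hL), HA ].
      apply (hyp L hL); in_context.
  - apply (impI L hL), (botE L hL), (impE L hL _ A).
    + apply (weaken_cons L hL), HA.
    + apply (hyp L hL); in_context.
Qed.

Lemma signed_bot L (hL : super_intuitionistic L) G : L G (signed false Bot).
Proof. apply (impI L hL), (hyp L hL); in_context. Qed.

Lemma literals_decide_qf L (hL : super_intuitionistic L) G v A :
  quantifier_free A ->
  (forall X, occurs X A -> L G (signed (v X) (Var X))) ->
  L G (signed (eval v A) A).
Proof.
  induction A as [ X | | A IHA B IHB | A IHA B IHB | A IHA B IHB
                 | X A IH | X A IH ]; simpl; intros Hq H;
    try contradiction.
  - auto.
  - apply (signed_bot L hL).
  - apply (signed_and L hL); [ apply IHA | apply IHB ]; (tauto || auto).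
  - apply (signed_or L hL); [ apply IHA | apply IHB ]; (tauto || auto).
  - apply (signed_imp L hL); [ apply IHA | apply IHB ]; (tauto || auto).
Qed.

Definition literals (v : var -> bool) (l : list var) : list form :=
  map (fun X => signed (v X) (Var X)) l.

Lemma instance_excluded_middle L (hL : super_intuitionistic L) G A :
  In excluded_middle G -> L G (Or A (Neg A)).
Proof.
  intros H. apply (allE L hL G 0 (Or (Var 0) (Neg (Var 0))) A).
  - intros Y _; simpl; tauto.
  - apply (hyp L hL), H.
Qed.

Lemma literals_upd v X b l : ~ In X l -> literals (upd v X b) l = literals v l.
Proof.
  intros HX. apply map_ext_in. intros Y HY. unfold upd.
  destruct (Nat.eq_dec X Y) as [ <- | ]; [ contradiction | reflexivity ].
Qed.

Lemma case_split L (hL : super_intuitionistic L) v X l B : ~ In X l ->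
  (forall b, L (excluded_middle :: literals (upd v X b) (X :: l)) B) ->
  L (excluded_middle :: literals v l) B.
Proof.
  intros HX H.
  assert (H' : forall b,
    L (signed b (Var X) :: excluded_middle :: literals v l) B).
  { intros b. specialize (H b). simpl in H.
    rewrite (literals_upd v X b l HX) in H.
    unfold upd in H. destruct (Nat.eq_dec X X) as [ _ | n ]; [ | congruence ].
    revert H. apply (weaken L hL). intros C; simpl; tauto. }
  apply (orE L hL _ (Var X) (Neg (Var X))).
  - apply (instance_excluded_middle L hL); in_context.
  - apply (H' true).
  - apply (H' false).
Qed.

Lemma not_free_in_literals X v l :
  ~ In X l -> not_free_in X (excluded_middle :: literals v l).
Proof.
  intros HX B [<- | HB]; [ simpl; tauto | ].
  unfold literals in HB.
  apply in_map_iff in HB as (Y & <- & HY). intros HF. apply HX.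
  enough (X = Y) as -> by exact HY.
  destruct (v Y); simpl in HF; tauto.
Qed.

(** Kalmár's lemma. A true universal or a false existential formula follows by
    case distinction on the bound variable; a false universal or a true
    existential one is settled by instantiating with the constant that makes
    its body false or true. The latter is why the induction is on the weight:
    the instance is not a subformula. *)
Lemma literals_decide L (hL : super_intuitionistic L) A : forall v l,
  (forall X, free X A -> In X l) ->
  L (excluded_middle :: literals v l) (signed (eval v A) A).
Proof.
  induction A as [A IH] using (induction_ltof1 _ weight).
  unfold ltof in IH.
  intros v l Hl.
  (* Both values of the bound variable give the same verdict on the body: drop
     the literal of that variable, so that it becomes an eigenvariable. *)
  assert (Hboth : forall X B c, weight B < weight A ->
    (forall Y, Y <> X /\ free Y B -> In Y l) ->
    (forall b, eval (upd v X b) B = c) ->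
    L (excluded_middle :: literals v (remove Nat.eq_dec X l)) (signed c B)).
  { intros X B c Hw HB Hc. apply (case_split L hL v X).
    { apply remove_In. }
    intros b. rewrite <- (Hc b). apply IH; [ exact Hw | ].
    intros Y HY. destruct (Nat.eq_dec X Y) as [ <- | n ]; [ left; reflexivity | ].
    right. apply in_in_remove; auto. }
  assert (Hone : forall X B b, weight B < weight A ->
    (forall Y, Y <> X /\ free Y B -> In Y l) ->
    L (excluded_middle :: literals v l)
      (signed (eval (upd v X b) B) (subst X (const b) B))).
  { intros X B b Hw HB. rewrite <- eval_subst_const. apply IH.
    - pose proof (weight_subst_const X b B). lia.
    - intros Y HY. apply HB, (free_subst_const X b), HY. }
  assert (Hdrop : forall X C,
    L (excluded_middle :: literals v (remove Nat.eq_dec X l)) C ->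
    L (excluded_middle :: literals v l) C).
  { intros X C. apply (weaken L hL).
    intros D [<- | HD]; [ left; reflexivity | right ].
    unfold literals in *. apply in_map_iff in HD as (Y & <- & HY).
    apply in_remove in HY. apply (in_map (fun X => signed (v X) (Var X))). tauto. }
  assert (Hfresh : forall X, not_free_in X
    (excluded_middle :: literals v (remove Nat.eq_dec X l))).
  { intros X. apply not_free_in_literals, remove_In. }
  destruct A as [ X | | A B | A B | A B | X A | X A ]; simpl in *.
  - apply (hyp L hL). right.
    apply (in_map (fun X => signed (v X) (Var X))). auto.
  - apply (signed_bot L hL).
  - apply (signed_and L hL); apply IH; auto; lia.
  - apply (signed_or L hL); apply IH; auto; lia.
  - apply (signed_imp L hL); apply IH; auto; lia.
  - assert (Hfalse : forall b, eval (upd v X b) A = false ->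
      L (excluded_middle :: literals v l) (Neg (All X A))).
    { intros b E. apply (impI L hL), (impE L hL _ (subst X (const b) A)).
      - specialize (Hone X A b). rewrite E in Hone.
        apply (weaken_cons L hL), Hone; auto.
      - apply (allE L hL); [ apply const_admissible | ].
        apply (hyp L hL); in_context. }
    destruct (eval (upd v X true) A) eqn:Et; simpl; [ | exact (Hfalse true Et) ].
    destruct (eval (upd v X false) A) eqn:Ef; simpl; [ | exact (Hfalse false Ef) ].
    apply (Hdrop X), (allI L hL); [ apply Hfresh | ].
    apply (Hboth X A true); auto. intros []; assumption.
  - assert (Htrue : forall b, eval (upd v X b) A = true ->
      L (excluded_middle :: literals v l) (Ex X A)).
    { intros b E. apply (exI L hL _ _ _ (const b)); [ apply const_admissible | ].
      specialize (Hone X A b). rewrite E in Hone. apply Hone; auto. }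
    destruct (eval (upd v X true) A) eqn:Et; simpl; [ exact (Htrue true Et) | ].
    destruct (eval (upd v X false) A) eqn:Ef; simpl; [ exact (Htrue false Ef) | ].
    assert (HA : L (excluded_middle :: literals v (remove Nat.eq_dec X l)) (Neg A)).
    { apply (Hboth X A false); auto. intros []; assumption. }
    apply (Hdrop X), (impI L hL), (exE L hL _ X A).
    + intros B [<- | [<- | HB]]; [ simpl; tauto | simpl; tauto | ].
      exact (Hfresh X B HB).
    + apply (hyp L hL); in_context.
    + apply (impE L hL _ A); [ | apply (hyp L hL); in_context ].
      do 2 apply (weaken_cons L hL). exact HA.
Qed.

(** * Post completeness of classical logic *)

Fixpoint vars (A : form) : list var :=
  match A with
  | Var X => [X]
  | Bot => []
  | And A B | Or A B | Imp A B => vars A ++ vars B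
  | All _ A | Ex _ A => vars A
  end.

Lemma free_vars X A : free X A -> In X (vars A).
Proof.
  induction A; simpl; try rewrite in_app_iff; intuition auto.
Qed.

Lemma classical_completeness L (hL : super_intuitionistic L) A :
  (forall v, eval v A = true) -> L [excluded_middle] A.
Proof.
  intros HA.
  set (l := nodup Nat.eq_dec (vars A)).
  assert (H : forall v, L (excluded_middle :: literals v l) A).
  { intros v. pose proof (literals_decide L hL A v l) as H.
    rewrite HA in H. apply H.
    intros X HX. apply nodup_In, free_vars, HX. }
  assert (Hl : NoDup l) by apply NoDup_nodup.
  clearbody l.
  induction Hl as [ | X l HX _ IH ].
  - exact (H (fun _ => true)).
  - apply IH. intros v. apply (case_split L hL v X); auto.
Qed.

Definition closure (l : list var) (A : form) : form := fold_right All A l.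

Lemma free_closure X l A : free X (closure l A) -> ~ In X l /\ free X A.
Proof.
  induction l as [ | Y l IH ]; simpl; [ tauto | ].
  intros [n H]. intuition auto.
Qed.

Lemma eval_closure v l A : eval v (closure l A) = true -> eval v A = true.
Proof.
  induction l as [ | X l IH ]; simpl; [ auto | ].
  intros [Ht Hf]%andb_true_iff. apply IH.
  rewrite <- (eval_ext _ (upd v X (v X))).
  - destruct (v X); assumption.
  - intros Y _. unfold upd. destruct (Nat.eq_dec X Y); congruence.
Qed.

Lemma consistent_sound L (hL : super_intuitionistic L)
  (hcons : ~ L [] Bot) (hem : L [] excluded_middle) A :
  L [] A -> forall v, eval v A = true.
Proof.
  intros HA v. apply (eval_closure v (vars A)).
  destruct (eval v (closure (vars A) A)) eqn:E; [ reflexivity | ].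
  exfalso. apply hcons.
  apply (impE L hL _ (closure (vars A) A)).
  - pose proof (literals_decide L hL (closure (vars A) A) v []) as H.
    rewrite E in H. apply (cut L hL _ excluded_middle); [ exact hem | ].
    apply H. intros X HX. apply free_closure in HX as [HX HF].
    exfalso. apply HX, free_vars, HF.
  - clear E. induction (vars A) as [ | X l IH ]; simpl; [ exact HA | ].
    apply (allI L hL); [ intros B [] | exact IH ].
Qed.

Fixpoint imps (G : list form) (A : form) : form :=
  match G with
  | [] => A
  | B :: G => imps G (Imp B A)
  end.

Lemma imps_intro L (hL : super_intuitionistic L) G : forall A,
  L G A -> L [] (imps G A).
Proof.
  induction G as [ | B G IH ]; simpl; intros A H; [ exact H | ].
  apply IH, (impI L hL), H.
Qed.

Lemma imps_elim L (hL : super_intuitionistic L) D G : forall A,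
  incl G D -> L D (imps G A) -> L D A.
Proof.
  induction G as [ | B G IH ]; simpl; intros A Hi H; [ exact H | ].
  apply incl_cons_inv in Hi as [HB HG].
  apply (impE L hL _ B); [ apply IH; assumption | apply (hyp L hL), HB ].
Qed.

Lemma post_completeness L (hL : super_intuitionistic L)
  (hcons : ~ L [] Bot) (hem : L [] excluded_middle) G A :
  L G A <-> classical_logic G A.
Proof.
  split.
  - intros H. unfold classical_logic.
    pose proof derivable_super_intuitionistic as hD.
    apply (imps_elim (fun G A => derivable (G ⊢ A)) hD _ G).
    { apply incl_tl, incl_refl. }
    apply (weaken _ hD [excluded_middle]).
    { intros B [<- | []]; left; reflexivity. }
    apply (classical_completeness _ hD).
    apply (consistent_sound L hL hcons hem), (imps_intro L hL), H.
  - intros H%(derivable_sub L hL).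
    apply (cut L hL _ excluded_middle); [ | exact H ].
    apply (weaken L hL []); [ apply incl_nil_l | exact hem ].
Qed.

(** * Excluded middle from the two hypotheses *)

(** The side premise [Var R] is discharged by instantiating [R] with a true
    constant, which is possible because [R] differs from [S]. *)
Lemma excluded_middle_of_dne L (hL : super_intuitionistic L) R S :
  R <> S -> L [Var R; Neg (Neg (Var S))] (Var S) -> L [] excluded_middle.
Proof.
  intros n H.
  assert (H1 : L [] (Imp (Neg (Neg (Var S))) (Imp (Var R) (Var S)))).
  { do 2 apply (impI L hL). exact H. }
  apply (allI L hL _ R) in H1; [ | intros B [] ].
  apply (allE L hL _ _ _ (const true)) in H1; [ | apply const_admissible ].
  simpl in H1.
  destruct (Nat.eq_dec R S) as [ | _ ]; [ contradiction | ].
  destruct (Nat.eq_dec R R) as [ _ | ]; [ | contradiction ].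
  apply (allI L hL _ S) in H1; [ | intros B [] ].
  apply (allE L hL _ _ _ (Or (Var 0) (Neg (Var 0)))) in H1;
    [ | intros Y _; simpl; tauto ].
  simpl in H1.
  destruct (Nat.eq_dec S S) as [ _ | ]; [ | contradiction ].
  apply (allI L hL); [ intros B [] | ].
  apply (impE L hL _ (const true)); [ | apply (impI L hL), (hyp L hL); in_context ].
  apply (impE L hL _ _ _ H1).
  apply (impI L hL), (impE L hL _ (Or (Var 0) (Neg (Var 0)))).
  { apply (hyp L hL); in_context. }
  apply (orI2 L hL), (impI L hL), (impE L hL _ (Or (Var 0) (Neg (Var 0)))).
  { apply (hyp L hL); in_context. }
  apply (orI1 L hL), (hyp L hL); in_context.
Qed.

Lemma neg_neg_mono L (hL : super_intuitionistic L) G A B :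
  L (A :: G) B -> In (Neg (Neg A)) G -> L G (Neg (Neg B)).
Proof.
  intros H HA. apply (impI L hL), (impE L hL _ (Neg A)).
  { apply (hyp L hL); right; exact HA. }
  apply (impI L hL), (impE L hL _ B). { apply (hyp L hL); in_context. }
  revert H. apply (weaken L hL). intros C; simpl; tauto.
Qed.

Lemma neg_neg_elim_neg L (hL : super_intuitionistic L) G A B :
  L (A :: G) (Neg B) -> In (Neg (Neg A)) G -> L G (Neg B).
Proof.
  intros H HA. apply (impI L hL), (impE L hL _ (Neg A)).
  { apply (hyp L hL); right; exact HA. }
  apply (impI L hL), (impE L hL _ B); [ | apply (hyp L hL); in_context ].
  revert H. apply (weaken L hL). intros C; simpl; tauto.
Qed.

Lemma imps_of_side_premise L (hL : super_intuitionistic L) G A B :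
  In A G -> L G (Imp (Neg A) B) /\ L G (Imp (Neg B) A).
Proof.
  intros HA. split; apply (impI L hL).
  - apply (botE L hL), (impE L hL _ A); apply (hyp L hL); in_context.
  - apply (hyp L hL); in_context.
Qed.

Lemma cut3 L (hL : super_intuitionistic L) G A B C D :
  L [A; B; C] D -> L G A -> L G B -> L G C -> L G D.
Proof.
  intros H HA HB HC.
  apply (impE L hL _ A); [ | exact HA ].
  apply (impE L hL _ B); [ | exact HB ].
  apply (impE L hL _ C); [ | exact HC ].
  apply (weaken L hL []); [ apply incl_nil_l | ].
  do 3 apply (impI L hL). exact H.
Qed.

Theorem theorem3p18
  (L : list form -> form -> Prop) (hL : super_intuitionistic L)
  (hcons : ~ L [] Bot)
  (P Q : var) (hPQ : P <> Q)
  (t : form) (ht : quantifier_free t)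
  (htPQ : forall X : var, occurs X t -> X = P \/ X = Q)
  (h1 : L [Imp (Neg (Var P)) (Var Q); Imp (Neg (Var Q)) (Var P); Neg t] (Var P))
  (h2 : L [Imp (Neg (Var P)) (Var Q); Imp (Neg (Var Q)) (Var P); Neg (Neg t)] (Var Q)) :
  forall (G : list form) (A : form), L G A <-> classical_logic G A.
Proof.
  intros G A. apply (post_completeness L hL hcons).
  assert (Ht : forall G, In (Var P) G -> In (Var Q) G ->
    L G (signed (eval (fun _ => true) t) t)).
  { intros D HP HQ. apply (literals_decide_qf L hL); [ exact ht | ].
    intros X [-> | ->]%htPQ; apply (hyp L hL); assumption. }
  destruct (eval (fun _ => true) t); simpl in Ht.
  - apply (excluded_middle_of_dne L hL P Q hPQ).
    destruct (imps_of_side_premise L hL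
      [Var P; Neg (Neg (Var Q))] (Var P) (Var Q)) as [H H']; [ in_context | ].
    apply (cut3 L hL _ _ _ _ _ h2 H H').
    apply (neg_neg_mono L hL _ (Var Q)); [ apply Ht | ]; in_context.
  - apply (excluded_middle_of_dne L hL Q P (not_eq_sym hPQ)).
    destruct (imps_of_side_premise L hL
      [Var Q; Neg (Neg (Var P))] (Var Q) (Var P)) as [H H']; [ in_context | ].
    apply (cut3 L hL _ _ _ _ _ h1 H' H).
    apply (neg_neg_elim_neg L hL _ (Var P)); [ apply Ht | ]; in_context.
Qed.
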